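(* Let $n\ge2$ and $\mu\in[0,1-\frac1n]$. Call a real number $\lambda$ a Lagrange multiplier (for the Kendall constraint) of problem (P) if there exist an $n\times n$ checkerboard copula $P=(p_{ij})$ with all entries strictly positive and $1-\mathrm{tr}(\Xi P\Xi P^\top)=\mu$, and vectors $\alpha,\beta\in\mathbb{R}^n$, such that for all $i,j\in\{1,\dots,n\}$ $$\log p_{ij}+1+\lambda\,(W\mathbf{p})_{ij}-\alpha_j-\beta_i=0 .$$ If every such Lagrange multiplier $\lambda$ satisfies $\lambda<2$, then problem (P) has a unique optimal solution.
   Context: An $n\times n$ checkerboard copula is a real $n\times n$ matrix with nonnegative entries whose row and column sums all equal $\frac1n$. $\Xi=(\xi_{ij})$ with $\xi_{ij}=1$ if $i=j$, $2$ if $i>j$, $0$ if $i<j$. Problem (P): minimize $I(P)=\sum_{i,j}p_{ij}\log p_{ij}$ (with $0\log0=0$) over $n\times n$ checkerboard copulas $P$ with $1-\mathrm{tr}(\Xi P\Xi P^\top)=\mu$. Here $\mathbf{p}=\mathrm{vec}(P)=(p_{11},p_{12},\dots,p_{1n},p_{21},\dots,p_{nn})^\top$ (row-major), $W=\frac12(\Xi\otimes\Xi^\top+\Xi^\top\otimes\Xi)\in\mathbb{R}^{n^2\times n^2}$ ($\otimes$ the Kronecker product), and $(W\mathbf{p})_{ij}$ denotes the entry of $W\mathbf{p}$ with index $n(i-1)+j$, i.e. $(W\mathbf{p})_{ij}=\frac12\sum_{a,b=1}^n(\xi_{ia}\xi_{bj}+\xi_{ai}\xi_{jb})p_{ab}$.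 *)

(* Defs.v *)
From HB Require Import structures.
From mathcomp Require Import all_boot all_order all_algebra.
From mathcomp Require Import all_classical all_reals all_analysis.
Set Implicit Arguments. Unset Strict Implicit. Unset Printing Implicit Defensive.
Import Order.TTheory GRing.Theory Num.Theory.
Local Open Scope ring_scope.

Section Defs.
Variables (R : realType) (n : nat).

Definition xi (i j : 'I_n) : R :=
  if i == j then 1 else if (j < i)%N then 2 else 0.

Definition Xi : 'M[R]_n := \matrix_(i, j) xi i j.

Definition checkerboard (P : 'M[R]_n) : Prop :=
  [/\ forall i j, 0 <= P i j,
      forall i, \sum_(j < n) P i j = (n%:R)^-1
    & forall j, \sum_(i < n) P i j = (n%:R)^-1].

Definition kendall (P : 'M[R]_n) : R := 1 - \tr (Xi *m P *m Xi *m P^T).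

Definition xlogx (x : R) : R := if x == 0 then 0 else x * ln x.

Definition Ient (P : 'M[R]_n) : R := \sum_(i < n) \sum_(j < n) xlogx (P i j).

Definition Wp (P : 'M[R]_n) (i j : 'I_n) : R :=
  2^-1 * \sum_(a < n) \sum_(b < n) (xi i a * xi b j + xi a i * xi j b) * P a b.

Definition feasible (mu : R) (P : 'M[R]_n) : Prop :=
  checkerboard P /\ kendall P = mu.

Definition lagrange_multiplier (mu lam : R) : Prop :=
  exists P : 'M[R]_n,
    [/\ checkerboard P, (forall i j, 0 < P i j), kendall P = mu &
      exists alpha beta : 'I_n -> R,
        forall i j, ln (P i j) + 1 + lam * Wp P i j - alpha j - beta i = 0].

Definition optimal (mu : R) (P : 'M[R]_n) : Prop :=
  feasible mu P /\ forall Q, feasible mu Q -> Ient P <= Ient Q.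

End Defs.

(* Main.v *)
Require Import Defs.
From HB Require Import structures.
From mathcomp Require Import all_boot all_order all_algebra.
From mathcomp Require Import all_classical all_reals all_analysis.
From mathcomp Require Import ring lra zify.
Import Order.TTheory GRing.Theory Num.Theory.
Import numFieldNormedType.Exports.
Local Open Scope ring_scope.

(** For a matrix [D] with vanishing margins, [|D^T W D| <= |D|_1 ^ 2 / 2]: any
    two zero-sum rows pair through mixed second differences of the sign function,
    which are at most 2 in absolute value, and across rows only signs occur.  If
    [P] is a positive critical point with multiplier [lam] and [Q] has the same
    Kendall value, then [I(Q) - I(P) = KL(Q || P) + lam / 2 * D^T W D] with
    [D = Q - P]; by Pinsker's inequality this is at least
    [(1 - lam / 2) / 2 * |D|_1 ^ 2], which is positive when [0 <= lam < 2].

    It remains to find such a critical point with [lam >= 0].  Minimise [I] over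
    the larger compact set [kendall >= mu].  Unless [P] is the comonotone copula
    [1 / n * Id], which is the only one with the maximal value [1 - 1 / n],
    some strictly positive copula lies in a direction increasing [kendall] to
    first order; hence the minimiser is positive and its multiplier is
    nonnegative.  Moving towards the independence copula shows that the
    constraint is active. *)

(** * The Kendall form *)

Section Form.
Variables (R : realType) (n : nat).
Implicit Types (P Q E : 'M[R]_n) (i j a b : 'I_n).
Local Notation xi := (@xi R n).

Definition tform P Q : R := \tr (Xi R n *m P *m Xi R n *m Q^T).

Lemma xi_ge0 i j : 0 <= xi i j.
Proof. by rewrite /Defs.xi; case: ifP => // _; case: ifP. Qed.

Lemma xi_le2 i j : xi i j <= 2.
Proof. by rewrite /Defs.xi; case: ifP => _; [|case: ifP => _]; lra. Qed.

Lemma xi_refl i : xi i i = 1.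
Proof. by rewrite /Defs.xi eqxx. Qed.

Lemma xi_swap i j : xi i j + xi j i = 2.
Proof.
rewrite /Defs.xi (eq_sym j i); case: eqVneq => [_|]; first by lra.
by rewrite -val_eqE /=; case: ltngtP => //= _ _; lra.
Qed.

Lemma xi_incr i j a : (i <= j)%N -> xi i a <= xi j a.
Proof.
rewrite /Defs.xi -!val_eqE /= => ij.
by do 2 (case: ltngtP => /=) => *; try lra; lia.
Qed.

Lemma xi_decr i j a : (i <= j)%N -> xi a j <= xi a i.
Proof. by move=> /(xi_incr _ _ a); have := xi_swap i a; have := xi_swap j a; lra. Qed.

Lemma tformE P Q :
  tform P Q = \sum_i \sum_j Q i j * \sum_a \sum_b xi i a * xi b j * P a b.
Proof.
rewrite /tform /mxtrace; apply: eq_bigr => i _.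
rewrite mxE; apply: eq_bigr => j _.
rewrite !mxE mulrC; congr (_ * _).
under eq_bigr => b _ do rewrite !mxE big_distrl /=.
rewrite exchange_big; apply: eq_bigr => a _; apply: eq_bigr => b _.
by rewrite !mxE mulrAC.
Qed.

Lemma tform_addl t P E Q : tform (P + t *: E) Q = tform P Q + t * tform E Q.
Proof.
by rewrite /tform mulmxDr mulmxDl mulmxDl mxtraceD -scalemxAr -!scalemxAl mxtraceZ.
Qed.

Lemma tform_addr t P E Q : tform Q (P + t *: E) = tform Q P + t * tform Q E.
Proof. by rewrite /tform linearD linearZ mulmxDr mxtraceD -scalemxAr mxtraceZ. Qed.

Lemma kendallE P : kendall P = 1 - tform P P.
Proof. by []. Qed.

(** [Wp P] is half the gradient of the quadratic form [tform P P], so pairing it with [E] gives half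
    the first variation of the form along [E]. *)
Lemma sum_Wp P E :
  \sum_i \sum_j E i j * Wp P i j = 2^-1 * (tform P E + tform E P).
Proof.
have -> : tform E P =
    \sum_i \sum_j E i j * \sum_a \sum_b xi a i * xi j b * P a b.
  rewrite tformE.
  under eq_bigr => i _ do under eq_bigr => j _ do rewrite big_distrr /=.
  under eq_bigr => i _ do rewrite exchange_big /=.
  rewrite exchange_big /=; apply: eq_bigr => a _.
  under eq_bigr => i _ do under eq_bigr => j _ do rewrite big_distrr /=.
  under eq_bigr => i _ do rewrite exchange_big /=.
  rewrite exchange_big /=; apply: eq_bigr => b _.
  rewrite big_distrr /=; apply: eq_bigr => i _.
  rewrite big_distrr /=; apply: eq_bigr => j _; ring.
rewrite tformE -big_split big_distrr /=; apply: eq_bigr => i _.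
rewrite -big_split big_distrr /=; apply: eq_bigr => j _.
rewrite -mulrDr /Wp mulrCA; congr (_ * (_ * _)).
rewrite -big_split; apply: eq_bigr => a _.
by rewrite -big_split; apply: eq_bigr => b _; rewrite mulrDl.
Qed.

Lemma kendall_add t P E :
  kendall (P + t *: E) =
  kendall P - t * (2 * \sum_i \sum_j E i j * Wp P i j) - t ^+ 2 * tform E E.
Proof. rewrite sum_Wp !kendallE tform_addl !tform_addr; by field. Qed.

Lemma sum_zero_le (I : finType) (u w : I -> R) (c : R) :
  \sum_i u i = 0 -> (forall i j : I, w i - w j <= c) ->
  `|\sum_i u i * w i| <= 2^-1 * c * \sum_i `|u i|.
Proof.
move=> u0 wc.
case: (pickP (fun _ : I => true)) => [i0 _|I0]; last first.
  by rewrite !big_pred0 // normr0 mulr0.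
pose M := w [arg max_(i > i0) w i]%O; pose m := w [arg min_(i < i0) w i]%O.
have wM (i : I) : w i <= M by rewrite /M; case: arg_maxP => // k _; apply.
have wm (i : I) : m <= w i by rewrite /m; case: arg_minP => // k _; apply.
have Mm : M - m <= c by exact: wc.
(* As [u] sums to zero, [w] may be recentred at the midpoint of its range, where its absolute value
   is at most half the oscillation. *)
have -> : \sum_i u i * w i = \sum_i u i * (w i - (M + m) / 2).
  under [RHS]eq_bigr => i _ do rewrite mulrBr.
  by rewrite sumrB -big_distrl /= u0 mul0r subr0.
apply: (le_trans (ler_norm_sum _ _ _)); rewrite big_distrr /=.
apply: ler_sum => i _; rewrite normrM mulrC ler_wpM2r //.
by rewrite ler_norml; have := wM i; have := wm i; lra.
Qed.

(** By [sum_zero_le] applied to [v], it suffices that the inner sum, as a function of [j],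
    oscillates by at most the l1 norm of [u]. *)
Lemma xi_bilinear_le (u v : 'I_n -> R) :
  \sum_b u b = 0 -> \sum_j v j = 0 ->
  `|\sum_j v j * \sum_b xi b j * u b| <= 2^-1 * (\sum_b `|u b|) * \sum_j `|v j|.
Proof.
move=> u0 v0; apply: sum_zero_le => // j k.
(* The shift by [s] is free because [u] sums to zero. By monotonicity the difference of the two [xi]
   lies in [0, 2] or in [-2, 0], according to the order of [j] and [k], and a shift by -1 or 1
   centres it. *)
have le_norm (s : R) : (forall b, `|xi b j - xi b k + s| <= 1) ->
    \sum_b xi b j * u b - \sum_b xi b k * u b <= \sum_b `|u b|.
  move=> hs.
  have -> : \sum_b xi b j * u b - \sum_b xi b k * u b =
     \sum_b (xi b j - xi b k + s) * u b.
    under [RHS]eq_bigr => b _ do rewrite mulrDl mulrBl.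
    by rewrite big_split sumrB -big_distrr /= u0 mulr0 addr0.
  apply: (le_trans (ler_norm _)); apply: (le_trans (ler_norm_sum _ _ _)).
  by apply: ler_sum => b _; rewrite normrM ler_piMl.
case: (leqP j k) => [jk|/ltnW kj].
- apply: (le_norm (-1)) => b.
  have := xi_decr _ _ b jk; have := xi_le2 b j; have := xi_ge0 b k.
  by rewrite ler_norml; lra.
- apply: (le_norm 1) => b.
  have := xi_decr _ _ b kj; have := xi_le2 b k; have := xi_ge0 b j.
  by rewrite ler_norml; lra.
Qed.

Lemma tform_zero_margins_le E :
  (forall i, \sum_j E i j = 0) -> (forall j, \sum_i E i j = 0) ->
  `|tform E E| <= 2^-1 * (\sum_i \sum_j `|E i j|) ^+ 2.
Proof.
move=> row0 col0.
pose c i a := \sum_j E i j * \sum_b xi b j * E a b.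
have c0 : \sum_i \sum_a c i a = 0.
  rewrite exchange_big big1 // => a _; rewrite /c exchange_big big1 // => j _.
  by rewrite -big_distrl /= col0 mul0r.
(* [c i a] pairs rows [i] and [a] of [E], and these pairings sum to zero. Subtracting 1 turns the
   weights [xi i a], which lie in [0, 2], into weights of absolute value at most 1. *)
have -> : tform E E = \sum_i \sum_a (xi i a - 1) * c i a.
  transitivity (\sum_i \sum_a xi i a * c i a); last first.
    under [RHS]eq_bigr => i _ do
      (under eq_bigr => a _ do rewrite mulrBl mul1r; rewrite sumrB).
    by rewrite sumrB c0 subr0.
  rewrite tformE; apply: eq_bigr => i _.
  under eq_bigr => j _ do rewrite big_distrr /=.
  rewrite exchange_big; apply: eq_bigr => a _; rewrite /c big_distrr /=.
  apply: eq_bigr => j _; rewrite !big_distrr /=; apply: eq_bigr => b _; ring.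
apply: (le_trans (ler_norm_sum _ _ _)).
rewrite expr2 big_distrl big_distrr /=; apply: ler_sum => i _.
apply: (le_trans (ler_norm_sum _ _ _)).
rewrite big_distrr big_distrr /=; apply: ler_sum => a _.
rewrite normrM; apply: (@le_trans _ _ `|c i a|).
  by rewrite ler_piMl // ler_norml; have := xi_ge0 i a; have := xi_le2 i a; lra.
by apply: (le_trans (xi_bilinear_le _ _ (row0 a) (row0 i))); rewrite mulrAC mulrA.
Qed.


(** * The comonotone and independence copulas *)

Lemma tformC P Q : tform P Q = tform Q^T P^T.
Proof. by rewrite /tform trmxK -mulmxA mxtrace_mulC mulmxA. Qed.

Definition comonotone : 'M[R]_n := (n%:R^-1)%:M.
Definition independence : 'M[R]_n := const_mx (n%:R^-1 ^+ 2).

Lemma checkerboard_trmx P : checkerboard P -> checkerboard P^T.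
Proof.
case=> P0 Pr Pc; split=> [i j|i|j]; first by rewrite mxE.
- by under eq_bigr => j _ do rewrite mxE; exact: Pc.
- by under eq_bigr => i _ do rewrite mxE; exact: Pr.
Qed.

Lemma checkerboard_comonotone : checkerboard comonotone.
Proof.
split=> [i j|i|j].
- by rewrite mxE mulrn_wge0 // invr_ge0 ler0n.
- rewrite (bigD1 i) //= big1 => [|j ji]; first by rewrite mxE eqxx mulr1n addr0.
  by rewrite mxE eq_sym (negPf ji) mulr0n.
- rewrite (bigD1 j) //= big1 => [|i ij]; first by rewrite mxE eqxx mulr1n addr0.
  by rewrite mxE (negPf ij) mulr0n.
Qed.

Lemma comonotone_form i j :
  \sum_a \sum_b xi i a * xi b j * comonotone a b =
  n%:R^-1 * \sum_a xi i a * xi a j.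
Proof.
rewrite big_distrr /=; apply: eq_bigr => a _.
rewrite (bigD1 a) //= big1 => [|b ba].
  by rewrite mxE eqxx mulr1n addr0 mulrC.
by rewrite mxE eq_sym (negPf ba) mulr0n mulr0.
Qed.

(* Summing [(xi i a - xi i b) * (xi b j - xi i j) >= 0] against [P a b]: the
   margins of [P] turn the cross terms into those of the comonotone copula. *)
Lemma comonotone_form_le P i j : checkerboard P ->
  \sum_a \sum_b xi i a * xi b j * comonotone a b <=
  \sum_a \sum_b xi i a * xi b j * P a b.
Proof.
case=> P0 Pr Pc; rewrite comonotone_form -subr_ge0.
have -> : \sum_a \sum_b xi i a * xi b j * P a b - n%:R^-1 * \sum_a xi i a * xi a j
    = \sum_a \sum_b (xi i a - xi i b) * (xi b j - xi i j) * P a b.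
  have rowE (f : 'I_n -> R) : \sum_a \sum_b f a * P a b = n%:R^-1 * \sum_a f a.
    rewrite big_distrr; apply: eq_bigr => a _ /=.
    by rewrite -big_distrr /= Pr mulrC.
  have colE (f : 'I_n -> R) : \sum_a \sum_b f b * P a b = n%:R^-1 * \sum_a f a.
    rewrite exchange_big big_distrr; apply: eq_bigr => a _ /=.
    by rewrite -big_distrr /= Pc mulrC.
  rewrite -(colE (fun a => xi i a * xi a j)).
  have -> : \sum_a \sum_b (xi i a - xi i b) * (xi b j - xi i j) * P a b =
     \sum_a \sum_b xi i a * xi b j * P a b
     - \sum_a \sum_b xi i b * xi b j * P a b
     - xi i j * (\sum_a \sum_b xi i a * P a b - \sum_a \sum_b xi i b * P a b).
    rewrite -!sumrB big_distrr -sumrB; apply: eq_bigr => a _.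
    rewrite -!sumrB big_distrr -sumrB; apply: eq_bigr => b _ /=; ring.
  by rewrite (rowE (xi i)) (colE (xi i)) subrr mulr0 subr0.
apply: sumr_ge0 => a _; apply: sumr_ge0 => b _; apply: mulr_ge0 => //.
(* Both factors are nonpositive if [b < i] and nonnegative if [i < b]: [xi i b] is then the extreme
   value 2 or 0, and [xi b j] is nondecreasing in [b]. For [b = i] the second factor is 0. *)
rewrite /Defs.xi -!val_eqE /=.
by do 4 (case: ltngtP => /=) => *; try lra; lia.
Qed.

Lemma tform_comonotone_le P Q : checkerboard P -> (forall i j, 0 <= Q i j) ->
  tform comonotone Q <= tform P Q.
Proof.
move=> Pcb Q0; rewrite !tformE; apply: ler_sum => i _; apply: ler_sum => j _.
by rewrite ler_wpM2l // comonotone_form_le.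
Qed.

(** Strictness comes from the entry [(i, j)] alone. Above the diagonal the comonotone sum is empty,
    since it would need [j <= a <= i], whereas the sum for [P] contains the term [P i j]. *)
Lemma tform_comonotone_lt P Q i j : checkerboard P -> (forall i j, 0 <= Q i j) ->
  (i < j)%N -> 0 < P i j -> 0 < Q i j -> tform comonotone Q < tform P Q.
Proof.
move=> Pcb Q0 ij Pij Qij; rewrite !tformE.
rewrite (bigD1 i) //= [ltRHS](bigD1 i) //=; apply: ltr_leD; last first.
  apply: ler_sum => k _; apply: ler_sum => l _.
  by rewrite ler_wpM2l // comonotone_form_le.
rewrite (bigD1 j) //= [ltRHS](bigD1 j) //=; apply: ltr_leD; last first.
  by apply: ler_sum => l _; rewrite ler_wpM2l // comonotone_form_le.
rewrite ltr_pM2l // comonotone_form big1 ?mulr0 => [|a _]; last first.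
  rewrite /Defs.xi -!val_eqE /=.
  by do 2 (case: ltngtP => /=) => *; try lra; lia.
case: Pcb => P0 _ _.
rewrite (bigD1 i) //= (bigD1 j) //= !xi_refl !mul1r -addrA ltr_pwDl //.
rewrite addr_ge0 //; first apply: sumr_ge0 => b _.
  by rewrite !mulr_ge0 ?xi_ge0.
by do 2 apply: sumr_ge0 => ? _; rewrite !mulr_ge0 ?xi_ge0.
Qed.

Lemma checkerboard_diag P : checkerboard P ->
  (forall i j, i != j -> P i j = 0) -> P = comonotone.
Proof.
case=> P0 Pr Pc Poff; apply/matrixP => i j; rewrite mxE.
case: eqVneq => [<-|ij]; last by rewrite mulr0n Poff.
rewrite mulr1n -(Pr i) (bigD1 i) //= big1 ?addr0 // => k ki.
by rewrite Poff // eq_sym.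
Qed.

(** This says that moving from [P] towards the comonotone copula increases [kendall] to first order.
    Both mixed terms are compared with [tform P P], one of them through transposition. A positive
    off-diagonal entry makes one comparison strict: directly if it lies above the diagonal, after
    transposing otherwise. *)
Lemma tform_comonotone_add_lt P : checkerboard P -> P != comonotone ->
  tform P comonotone + tform comonotone P < 2 * tform P P.
Proof.
move=> Pcb Pn.
have PTcb := checkerboard_trmx _ Pcb.
have [P0 _ _] := Pcb.
have PT0 i j : 0 <= P^T i j by rewrite mxE.
have trC : tform comonotone P^T = tform P comonotone.
  by rewrite tformC trmxK tr_scalar_mx.
have le1 := tform_comonotone_le _ _ Pcb P0.
have := tform_comonotone_le _ _ PTcb PT0; rewrite trC -tformC => le2.
have [i [j [ij Pij]]] : exists i j, i != j /\ P i j != 0.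
  apply: contrapT => h; move/eqP: Pn; apply; apply: checkerboard_diag => // i j ij.
  by apply/eqP/negPn/negP => Pij; apply: h; exists i, j.
have {}Pij : 0 < P i j by rewrite lt_neqAle eq_sym Pij P0.
move: ij; rewrite -val_eqE neq_ltn => /orP[ij|ji].
- by have := tform_comonotone_lt _ _ _ _ Pcb P0 ij Pij Pij; lra.
- have PTji : 0 < P^T j i by rewrite mxE.
  have := tform_comonotone_lt _ _ _ _ PTcb PT0 ji PTji PTji.
  by rewrite trC -tformC; lra.
Qed.

Lemma kendall_comonotone : (0 < n)%N -> kendall comonotone = 1 - n%:R^-1.
Proof.
move=> n0; congr (1 - _).
have nR : n%:R != 0 :> R by rewrite pnatr_eq0 -lt0n.
rewrite -/(tform comonotone comonotone) tformE.
transitivity (\sum_(i < n) n%:R^-1 * n%:R^-1 : R); last first.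
  by rewrite sumr_const card_ord -[_ *+ n]mulr_natr -mulrA mulVf // mulr1.
apply: eq_bigr => i _.
rewrite (bigD1 i) //= [X in _ + X]big1 => [|j ji]; last first.
  by rewrite mxE eq_sym (negPf ji) mulr0n mul0r.
rewrite comonotone_form mxE eqxx mulr1n addr0.
rewrite (bigD1 i) //= big1 => [|a ai]; first by rewrite !xi_refl mulr1 addr0 mulr1.
move: ai; rewrite /Defs.xi -!val_eqE /=.
by case: ltngtP => /= *; lra.
Qed.

Lemma kendall_lt P : (0 < n)%N -> checkerboard P -> P != comonotone ->
  kendall P < 1 - n%:R^-1.
Proof.
move=> n0 Pcb Pn; have := tform_comonotone_add_lt _ Pcb Pn.
have [M0 _ _] := checkerboard_comonotone.
have [P0 _ _] := Pcb.
have le1 := tform_comonotone_le _ _ Pcb M0.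
have le2 := tform_comonotone_le _ _ Pcb P0.
have PTcb := checkerboard_trmx _ Pcb.
have := tform_comonotone_le _ _ PTcb M0.
rewrite [tform P^T _]tformC trmxK tr_scalar_mx -/comonotone.
have := kendall_comonotone n0; rewrite !kendallE; lra.
Qed.

Lemma checkerboard_independence : (0 < n)%N -> checkerboard independence.
Proof.
move=> n0; have nR : n%:R != 0 :> R by rewrite pnatr_eq0 -lt0n.
split=> [i j|i|j]; first by rewrite mxE sqr_ge0.
- under eq_bigr => j _ do rewrite mxE.
  by rewrite sumr_const card_ord -[_ *+ n]mulr_natr expr2 -mulrA mulVf // mulr1.
- under eq_bigr => j' _ do rewrite mxE.
  by rewrite sumr_const card_ord -[_ *+ n]mulr_natr expr2 -mulrA mulVf // mulr1.
Qed.

Lemma independence_gt0 i j : 0 < independence i j.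
Proof. by rewrite mxE exprn_gt0 // invr_gt0 ltr0n (leq_ltn_trans _ (ltn_ord i)). Qed.

(** The form factors through the total sum of [Xi], which is [n ^ 2] because [xi i j] and [xi j i]
    average to 1. *)
Lemma kendall_independence : (0 < n)%N -> kendall independence = 0.
Proof.
move=> n0; have nR : n%:R != 0 :> R by rewrite pnatr_eq0 -lt0n.
have sum_xi : \sum_i \sum_j xi i j = n%:R ^+ 2.
  have : \sum_i \sum_j (xi i j + xi j i) = 2 * n%:R ^+ 2.
    under eq_bigr => i _ do under eq_bigr => j _ do rewrite xi_swap.
    rewrite !sumr_const card_ord -[_ *+ n]mulr_natr -[2 *+ n]mulr_natr; ring.
  under eq_bigr => i _ do rewrite big_split.
  by rewrite big_split /= [X in _ + X]exchange_big /=; lra.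
apply/eqP; rewrite kendallE subr_eq0 eq_sym; apply/eqP.
rewrite tformE.
transitivity (n%:R^-1 ^+ 4 * ((\sum_i \sum_a xi i a) * (\sum_b \sum_j xi b j))).
  rewrite big_distrl big_distrr; apply: eq_bigr => i _ /=.
  rewrite [X in _ * X]mulrC exchange_big /= big_distrl big_distrr.
  apply: eq_bigr => j _ /=; rewrite mxE mulrC big_distrl /=.
  rewrite [RHS]mulrC big_distrl /= big_distrl /=.
  rewrite [LHS](_ : _ = \sum_b \sum_a xi i a * xi b j * n%:R^-1 ^+ 4).
    apply: eq_bigr => b _; rewrite big_distrr /= big_distrl /=.
    by apply: eq_bigr => a _; ring.
  rewrite exchange_big; apply: eq_bigr => a _ /=; rewrite big_distrl /=.
  by apply: eq_bigr => b _; rewrite mxE; ring.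
by rewrite sum_xi; field.
Qed.

End Form.

Arguments tform {R n}.

(** * Entropy and Pinsker's inequality *)

Section Entropy.
Variable R : realType.
Implicit Types x y u : R.
Local Open Scope classical_set_scope.

Lemma xlogxE x : xlogx x = x * ln x.
Proof. by rewrite /xlogx; case: eqVneq => [->|//]; rewrite mul0r. Qed.

(* The difference of the two sides has derivative
   [(u - 1) ^+ 3 / (u ^+ 2 * (u + 2) ^+ 2)]. *)
Lemma ln_ge_pade u : 0 < u ->
  5 / 2 - 4^-1 * u^-1 - 27 / 4 * (u + 2)^-1 <= ln u.
Proof.
pose F v : R := ln v + (4^-1 * v^-1 + 27 / 4 * (v + 2)^-1).
pose dF v : R := v^-1 - 4^-1 * (v ^- 2) - 27 / 4 * ((v + 2) ^- 2).
have F1 : F 1 = 5 / 2 by rewrite /F ln1; field.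
have dFE (v : R) : 0 < v -> dF v = (v - 1) ^+ 3 / (v ^+ 2 * (v + 2) ^+ 2).
  by move=> v0; rewrite /dF; field; rewrite !gt_eqF //; lra.
have FD (v : R) : 0 < v -> is_derive v 1 F (dF v).
  move=> v0; have v2 : v + 2 != 0 by rewrite gt_eqF //; lra.
  have vn : v != 0 by rewrite gt_eqF.
  have h1 : is_derive v 1 (fun v : R => v^-1) (- v ^- 2 *: 1).
    exact: is_deriveV.
  have h2 : is_derive v 1 (fun v : R => (v + 2)^-1) (- (v + 2) ^- 2 *: (1 + 0)).
    exact: is_deriveV.
  have h := is_deriveD (is_derive1_ln v0)
    (is_deriveD (is_deriveZ (4^-1 : R) h1) (is_deriveZ (27 / 4 : R) h2)).
  apply: (is_derive_eq h); rewrite /dF /GRing.scale /=; ring.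
have Fcont (a b : R) : 0 < a -> {within `[a, b], continuous F}.
  move=> a0; apply: derivable_within_continuous => v.
  rewrite in_itv /= => /andP[av _].
  by have [] := FD v (lt_le_trans a0 av).
move=> u0; suff : F 1 <= F u by rewrite F1 /F; lra.
have [u1|u1|->//] := ltgtP u 1.
- have FDu v : v \in `]u, 1[%R -> is_derive v 1 F (dF v).
    by rewrite in_itv /= => /andP[uv _]; apply: FD; apply: lt_trans uv.
  have [] := MVT u1 FDu (Fcont u 1 u0).
  move=> c; rewrite in_itv /= => /andP[uc c1] Fc; rewrite -subr_le0 Fc.
  have c0 := lt_trans u0 uc.
  rewrite dFE // mulr_le0_ge0 ?subr_ge0 ?(ltW u1) //.
  rewrite mulr_le0_ge0 //; last by rewrite invr_ge0 -exprMn sqr_ge0.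
  by rewrite exprS mulr_le0_ge0 ?sqr_ge0 // subr_le0 ltW.
- have FDu v : v \in `]1, u[%R -> is_derive v 1 F (dF v).
    by rewrite in_itv /= => /andP[uv _]; apply: FD; apply: lt_trans uv.
  have [] := MVT u1 FDu (Fcont 1 u ltr01).
  move=> c; rewrite in_itv /= => /andP[c1 cu] Fc; rewrite -subr_ge0 Fc.
  have c0 := lt_trans ltr01 c1.
  rewrite dFE // mulr_ge0 ?subr_ge0 ?(ltW u1) //.
  rewrite mulr_ge0 //; last by rewrite invr_ge0 -exprMn sqr_ge0.
  by rewrite exprn_ge0 // subr_ge0 ltW.
Qed.

(** For positive [x] this is [ln_ge_pade] at [u = x / y], multiplied by [x]. The denominator
    [x + 2 * y] is chosen for Pinsker's inequality: over two probability vectors it sums to 3. *)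
Lemma xlogx_bregman x y : 0 <= x -> 0 < y ->
  3 / 2 * (x - y) ^+ 2 / (x + 2 * y) <=
  xlogx x - xlogx y - (ln y + 1) * (x - y).
Proof.
move=> x0 y0; rewrite !xlogxE.
have [->|xn] := eqVneq x 0.
  have -> : 3 / 2 * (0 - y) ^+ 2 / (0 + 2 * y) = 3 / 4 * y.
    by field; rewrite gt_eqF.
  by rewrite mul0r; lra.
have {xn x0} x0 : 0 < x by rewrite lt_neqAle eq_sym xn.
have xy0 : 0 < x / y by rewrite divr_gt0.
have := ln_ge_pade _ xy0.
rewrite ln_div // => /(ler_wpM2l (ltW x0)).
have -> : x * (5 / 2 - 4^-1 * (x / y)^-1 - 27 / 4 * (x / y + 2)^-1)
   = 3 / 2 * (x - y) ^+ 2 / (x + 2 * y) + x - y.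
  field; rewrite !gt_eqF //; lra.
lra.
Qed.

Lemma xlogx_tangent x y : 0 <= x -> 0 < y ->
  xlogx y + (ln y + 1) * (x - y) <= xlogx x.
Proof.
move=> x0 y0; have := xlogx_bregman _ _ x0 y0.
have : 0 <= 3 / 2 * (x - y) ^+ 2 / (x + 2 * y).
  by apply: divr_ge0; [apply: mulr_ge0; [lra|exact: sqr_ge0]|lra].
lra.
Qed.

Lemma pinsker (I : finType) (p q : I -> R) :
  (forall i, 0 < p i) -> (forall i, 0 <= q i) ->
  \sum_i p i = 1 -> \sum_i q i = 1 ->
  \sum_i xlogx (p i) + \sum_i (ln (p i) + 1) * (q i - p i)
    + 2^-1 * (\sum_i `|q i - p i|) ^+ 2 <= \sum_i xlogx (q i).
Proof.
move=> p0 q0 p1 q1; set S := \sum_i `|_|.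
(* Completing the square replaces the Cauchy-Schwarz inequality. Since the weights [q i + 2 * p i]
   sum to 3, the added terms total [S ^ 2 - S ^ 2 / 2]. *)
have : \sum_i (xlogx (p i) + (ln (p i) + 1) * (q i - p i)
    + (S * `|q i - p i| - 6^-1 * S ^+ 2 * (q i + 2 * p i))) <= \sum_i xlogx (q i).
  apply: ler_sum => i _; have := xlogx_bregman _ _ (q0 i) (p0 i).
  set d := q i - p i; set w := q i + 2 * p i.
  have w0 : 0 < w by rewrite /w; have := p0 i; have := q0 i; lra.
  suff : S * `|d| - 6^-1 * S ^+ 2 * w <= 3 / 2 * d ^+ 2 / w by lra.
  rewrite ler_pdivlMr // -subr_ge0.
  have -> : 3 / 2 * d ^+ 2 - (S * `|d| - 6^-1 * S ^+ 2 * w) * w =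
     3 / 2 * (`|d| - 3^-1 * S * w) ^+ 2.
    by rewrite -(real_normK (num_real d)); field.
  by apply: mulr_ge0; [lra|exact: sqr_ge0].
rewrite !big_split sumrN -!big_distrr /= big_split -big_distrr /= p1 q1 -/S.
lra.
Qed.

Lemma continuous_xlogx : continuous (@xlogx R).
Proof.
move=> x; have -> : @xlogx R = (fun y : R => y * ln y) by apply/funext => y; rewrite xlogxE.
have [x0|x0|->] := ltgtP x 0.
(* [ln] takes the value 0 on nonpositive reals, so the function is locally constant here. *)
- apply: (@cvg_trans _ ((fun=> x * ln x) @ nbhs x)); last exact: cvg_cst.
  apply: near_eq_cvg; near=> y.
  have y0 : y < 0 by near: y; exact: lt_nbhsl.
  by rewrite !ln0 ?mulr0 ?ltW.
- by apply: cvgM; [exact: cvg_id|exact: continuous_ln].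
- rewrite /continuous_at mul0r.
  (* For positive [y], the upper bound is [ln y < y]; the lower one is the same inequality at
     [1 / s] with [s] the square root of [y], which gives [s * ln s >= -1]. *)
  apply: (@squeeze_cvgr _ _ _ _ (fun y : R => - (2 * Num.sqrt y)) (fun y : R => y * y)).
  + near=> y; have [y0|y0] := leP y 0.
      rewrite ln0 // mulr0 oppr_le0 mulr_ge0 ?sqrtr_ge0 //=.
      by rewrite -expr2 sqr_ge0.
    apply/andP; split; last by rewrite ler_wpM2l ?ltW // ln_sublinear.
    set s := Num.sqrt y.
    have s0 : 0 < s by rewrite sqrtr_gt0.
    have -> : y = s * s by rewrite -expr2 sqr_sqrtr ?ltW.
    rewrite lnM ?posrE //.
    have := @ln_sublinear R s^-1; rewrite invr_gt0 => /(_ s0).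
    rewrite lnV ?posrE // => /ltW /(ler_wpM2l (ltW s0)).
    rewrite divff ?gt_eqF // => h.
    have := ler_wpM2l (ltW s0) h; lra.
  + have sqrt0 : Num.sqrt y @[y --> (0 : R)] --> Num.sqrt (0 : R).
      exact: sqrt_continuous.
    have := cvgN (cvgM (cvg_cst (2 : R)) sqrt0); rewrite sqrtr0 mulr0 oppr0; exact.
  + rewrite -[X in _ --> X](mulr0 0); by apply: cvgM; exact: cvg_id.
Unshelve. all: by end_near. Qed.

End Entropy.

(** * Critical points *)

Section Optimum.
Variables (R : realType) (n : nat).
Hypothesis n_gt0 : (0 < n)%N.
Implicit Types (P Q E : 'M[R]_n) (i j a b : 'I_n) (mu lam t : R).
Local Notation comonotone := (comonotone R n).
Local Notation independence := (independence R n).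

Definition zero_margins E :=
  (forall i, \sum_j E i j = 0) /\ (forall j, \sum_i E i j = 0).

(** The first variations along [E] of [Ient], at a positive [P], and of [kendall], where it is the
    linear coefficient in [kendall_add]. *)
Definition entropy_slope P E := \sum_i \sum_j (ln (P i j) + 1) * E i j.
Definition kendall_slope P E := - (2 * \sum_i \sum_j E i j * Wp P i j).

Lemma zero_margins_sub P Q : checkerboard P -> checkerboard Q ->
  zero_margins (Q - P).
Proof.
move=> [_ Pr Pc] [_ Qr Qc]; split=> [i|j].
- by under eq_bigr => j _ do rewrite !mxE; rewrite sumrB Pr Qr subrr.
- by under eq_bigr => i _ do rewrite !mxE; rewrite sumrB Pc Qc subrr.
Qed.

Lemma checkerboard_addZ P E t : checkerboard P -> zero_margins E ->
  (forall i j, 0 <= (P + t *: E) i j) -> checkerboard (P + t *: E).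
Proof.
move=> [_ Pr Pc] [Er Ec] E0; split=> // [i|j].
- under eq_bigr => j _ do rewrite !mxE.
  by rewrite big_split -big_distrr /= Pr Er mulr0 addr0.
- under eq_bigr => i _ do rewrite !mxE.
  by rewrite big_split -big_distrr /= Pc Ec mulr0 addr0.
Qed.

Lemma checkerboard_sum1 P : checkerboard P -> \sum_i \sum_j P i j = 1.
Proof.
move=> [_ Pr _]; under eq_bigr => i _ do rewrite Pr.
by rewrite sumr_const card_ord -[_ *+ n]mulr_natr mulVf // pnatr_eq0 -lt0n.
Qed.

Lemma Ient_tangent P Q : (forall i j, 0 <= Q i j) -> (forall i j, 0 < P i j) ->
  Ient P + entropy_slope P (Q - P) <= Ient Q.
Proof.
move=> Q0 P0; rewrite /Ient /entropy_slope -big_split; apply: ler_sum => i _.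
rewrite -big_split; apply: ler_sum => j _; rewrite !mxE; exact: xlogx_tangent.
Qed.

Lemma Ient_pinsker P Q : checkerboard P -> checkerboard Q ->
  (forall i j, 0 < P i j) ->
  Ient P + entropy_slope P (Q - P)
    + 2^-1 * (\sum_i \sum_j `|(Q - P) i j|) ^+ 2 <= Ient Q.
Proof.
move=> Pcb Qcb P0; have [Q0 _ _] := Qcb.
have := @pinsker R _ (fun k : 'I_n * 'I_n => P k.1 k.2) (fun k => Q k.1 k.2).
rewrite -(pair_bigA _ (fun i j => P i j)) -(pair_bigA _ (fun i j => Q i j)) /=.
rewrite !checkerboard_sum1 // => /(_ (fun=> P0 _ _) (fun=> Q0 _ _) erefl erefl).
rewrite -(pair_bigA _ (fun i j => xlogx (P i j))).
rewrite -(pair_bigA _ (fun i j => xlogx (Q i j))).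
rewrite -(pair_bigA _ (fun i j => (ln (P i j) + 1) * (Q i j - P i j))).
rewrite -(pair_bigA _ (fun i j => `|Q i j - P i j|)) /=.
have -> : \sum_i \sum_j (ln (P i j) + 1) * (Q i j - P i j) = entropy_slope P (Q - P).
  by apply: eq_bigr => i _; apply: eq_bigr => j _; rewrite !mxE.
have -> // : \sum_i \sum_j `|Q i j - P i j| = \sum_i \sum_j `|(Q - P) i j|.
by apply: eq_bigr => i _; apply: eq_bigr => j _; rewrite !mxE.
Qed.

Lemma l1norm_gt0 P Q : Q != P -> 0 < \sum_i \sum_j `|(Q - P) i j|.
Proof.
move=> QP; have s0 : 0 <= \sum_i \sum_j `|(Q - P) i j|.
  by do 2 apply: sumr_ge0 => ? _.
rewrite lt_neqAle s0 andbT eq_sym; apply: contra QP => /eqP.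
move/psumr_eq0P => rows0; apply/eqP/matrixP => i j; apply/eqP.
have /psumr_eq0P cols0 := rows0 (fun _ _ => sumr_ge0 _ (fun _ _ => normr_ge0 _)) i isT.
by have := cols0 (fun _ _ => normr_ge0 _) j isT; move/normr0_eq0; rewrite !mxE -subr_eq0 => ->.
Qed.

(* As [kendall Q = kendall P], the first order variation of the quadratic
   constraint towards [Q] is half of [tform (Q - P) (Q - P)] up to sign, so the
   critical point equation turns the entropy slope into [lam / 2] times it. *)
Lemma kkt_lt P Q lam (alpha beta : 'I_n -> R) :
  checkerboard P -> checkerboard Q -> (forall i j, 0 < P i j) ->
  kendall P = kendall Q -> 0 <= lam < 2 ->
  (forall i j, ln (P i j) + 1 + lam * Wp P i j - alpha j - beta i = 0) ->
  Q != P -> Ient P < Ient Q.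
Proof.
move=> Pcb Qcb P0 PQ /andP[lam0 lam2] kkt QP.
have [Dr Dc] := zero_margins_sub _ _ Pcb Qcb.
have := Ient_pinsker _ _ Pcb Qcb P0.
have := tform_zero_margins_le _ _ _ Dr Dc.
have := l1norm_gt0 _ _ QP.
set S := \sum_i \sum_j `|_| => S0 /ler_normlP[form_le _].
have -> : entropy_slope P (Q - P) = lam / 2 * tform (Q - P) (Q - P).
  transitivity (- lam * \sum_i \sum_j (Q - P) i j * Wp P i j).
    (* The terms in [alpha] and [beta] pair to zero with [Q - P], whose margins vanish, so they can
       be subtracted for free. *)
    rewrite -[LHS]subr0.
    have {1}<- : \sum_i \sum_j alpha j * (Q - P) i j
        + \sum_i beta i * \sum_j (Q - P) i j = 0.
      rewrite [X in X + _]exchange_big /=.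
      rewrite [X in X + _]big1 => [|j _]; last by rewrite -big_distrr /= Dc mulr0.
      by rewrite big1 ?addr0 // => i _; rewrite Dr mulr0.
    rewrite /entropy_slope big_distrr -big_split -sumrB; apply: eq_bigr => i _ /=.
    rewrite !big_distrr -big_split -sumrB; apply: eq_bigr => j _ /=.
    have /eqP := kkt i j; rewrite subr_eq0 subr_eq => /eqP h.
    have -> : ln (P i j) + 1 = beta i + alpha j - lam * Wp P i j by rewrite -h; ring.
    ring.
  have := kendall_add _ _ 1 P (Q - P).
  rewrite scale1r addrC subrK -PQ mul1r expr1n mul1r => h.
  suff -> : \sum_i \sum_j (Q - P) i j * Wp P i j = - 2^-1 * tform (Q - P) (Q - P).
    by field.
  lra.
have S2 : 0 < S ^+ 2 by rewrite exprn_gt0.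
(* Pinsker contributes [S ^ 2 / 2], and the slope costs at most [lam / 4 * S ^ 2]; this is what
   remains. *)
have : 0 < (2 - lam) / 4 * S ^+ 2 by rewrite mulr_gt0 //; lra.
have : 0 <= lam / 2 * (tform (Q - P) (Q - P) + 2^-1 * S ^+ 2).
  by rewrite mulr_ge0 //; lra.
lra.
Qed.

End Optimum.

Arguments zero_margins {R n}.
Arguments entropy_slope {R n}.
Arguments kendall_slope {R n}.

(** * Existence of minimisers *)

Section Existence.
Variables (R : realType) (n : nat).
Implicit Types (P Q E : 'M[R]_n) (i j a b : 'I_n) (mu lam t : R).
Local Open Scope classical_set_scope.

(** With an inequality constraint, directions that increase [kendall] stay admissible, which will
    fix the sign of the multiplier. *)
Definition entropy_minimizer mu P :=
  [/\ checkerboard P, mu <= kendall P &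
    forall Q, checkerboard Q -> mu <= kendall Q -> Ient P <= Ient Q].

Lemma continuous_sum (T : topologicalType) (I : finType) (F : I -> T -> R) :
  (forall k : I, continuous (F k)) -> continuous (fun x : T => \sum_k F k x).
Proof. by move=> Fc; apply: continuous_big => //; exact: add_continuous. Qed.

Lemma continuous_mul (T : topologicalType) (f g : T -> R) :
  continuous f -> continuous g -> continuous (fun x => f x * g x).
Proof. by move=> fc gc x; exact: (continuousM (fc x) (gc x)). Qed.

Lemma continuous_vec_mx i j :
  continuous (fun v : 'rV[R]_(n * n) => vec_mx v i j).
Proof.
under eq_fun => v do rewrite mxE.
exact: coord_continuous.
Qed.

Lemma continuous_kendall :
  continuous (fun v : 'rV[R]_(n * n) => kendall (vec_mx v)).
Proof.
under eq_fun => v do rewrite kendallE tformE.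
move=> x; apply: continuousB; first exact: cst_continuous.
move: x; do 2 apply: continuous_sum => ?.
apply: continuous_mul; first exact: continuous_vec_mx.
do 2 apply: continuous_sum => ?.
by apply: continuous_mul; [move=> ?; exact: cst_continuous|exact: continuous_vec_mx].
Qed.

Lemma continuous_Ient :
  continuous (fun v : 'rV[R]_(n * n) => Ient (vec_mx v)).
Proof.
do 2 apply: continuous_sum => ?.
move=> x; apply: continuous_comp; first exact: continuous_vec_mx.
exact: continuous_xlogx.
Qed.

Lemma closed_level_ge (T : topologicalType) (f : T -> R) c :
  continuous f -> closed [set x | c <= f x].
Proof. by move/continuous_closedP => /(_ [set y | c <= y]); apply; exact: closed_ge. Qed.

Lemma closed_level_eq (T : topologicalType) (f : T -> R) c :
  continuous f -> closed [set x | f x = c].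
Proof. by move/continuous_closedP => /(_ [set y | y = c]); apply; exact: closed_eq. Qed.

Lemma closed_forall (T : topologicalType) (I : Type) (A : I -> set T) :
  (forall k : I, closed (A k)) -> closed [set x | forall k : I, A k x].
Proof.
move=> Ac; rewrite (_ : [set _ | _] = \bigcap_i A i); first exact: closed_bigI.
by apply/seteqP; split => x h // i; exact: h.
Qed.

(** Flattened to row vectors, the set is closed in a product of segments: a nonnegative entry is at
    most its row sum [1 / n]. *)
Lemma compact_checkerboard_kendall_ge mu :
  compact [set v : 'rV[R]_(n * n) |
    checkerboard (vec_mx v) /\ mu <= kendall (vec_mx v)].
Proof.
apply: (@subclosed_compact _ _
  [set v : 'rV[R]_(n * n) | forall k, `[0 : R, n%:R^-1] (v ord0 k)]).
- rewrite (_ : [set _ | _] =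
    ([set v | forall i j, 0 <= vec_mx v i j]
    `&` [set v | forall i, \sum_j vec_mx v i j = n%:R^-1]
    `&` [set v | forall j, \sum_i vec_mx v i j = n%:R^-1])
    `&` [set v | mu <= kendall (vec_mx v)]); last first.
    by apply/seteqP; split=> v /=; [case=> [[? ? ?] ?]|case=> [[[? ?] ?] ?]].
  apply: closedI; first apply: closedI; first apply: closedI.
  + do 2 apply: closed_forall => ?.
    by apply: closed_level_ge; exact: continuous_vec_mx.
  + apply: closed_forall => ?; apply: closed_level_eq.
    by apply: continuous_sum => ?; exact: continuous_vec_mx.
  + apply: closed_forall => ?; apply: closed_level_eq.
    by apply: continuous_sum => ?; exact: continuous_vec_mx.
  + by apply: closed_level_ge; exact: continuous_kendall.
- by apply: (@rV_compact R _ (fun=> `[0 : R, n%:R^-1])) => k; exact: segment_compact.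
- move=> v /= [[v0 vr _] _] k; case/mxvec_indexP: k => i j.
  rewrite in_itv /=; have := v0 i j; rewrite mxE => -> /=.
  rewrite -(vr i) (bigD1 j) //= mxE lerDl; apply: sumr_ge0 => l _; exact: v0.
Qed.

Lemma entropy_minimizer_exists mu : (0 < n)%N -> mu <= 1 - n%:R^-1 ->
  exists P, entropy_minimizer mu P.
Proof.
move=> n0 mule.
have [|v] := compact_EVT_min _ (compact_checkerboard_kendall_ge mu)
  (continuous_subspaceT continuous_Ient).
  exists (mxvec (comonotone R n)) => /=; rewrite mxvecK.
  by split; [exact: checkerboard_comonotone|rewrite kendall_comonotone].
rewrite inE => -[vcb vk] vmin; exists (vec_mx v); split=> // Q Qcb Qk.
by have := vmin (mxvec Q); rewrite inE /= mxvecK; apply.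
Qed.

End Existence.

Arguments entropy_minimizer {R n}.

(** * First order conditions *)

Section FirstOrder.
Variables (R : realType) (n : nat).
Implicit Types (P Q E : 'M[R]_n) (i j a b : 'I_n) (mu lam t : R).
Local Open Scope classical_set_scope.

Lemma entropy_slopeDZ P t E E' :
  entropy_slope P (E + t *: E') = entropy_slope P E + t * entropy_slope P E'.
Proof.
rewrite /entropy_slope big_distrr -big_split; apply: eq_bigr => i _.
rewrite big_distrr -big_split; apply: eq_bigr => j _ /=; rewrite !mxE; ring.
Qed.

Lemma kendall_slopeDZ P t E E' :
  kendall_slope P (E + t *: E') = kendall_slope P E + t * kendall_slope P E'.
Proof.
rewrite /kendall_slope mulrN mulrCA -opprD -mulrDr; congr (- (_ * _)).
rewrite big_distrr -big_split; apply: eq_bigr => i _.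
rewrite big_distrr -big_split; apply: eq_bigr => j _ /=; rewrite !mxE; ring.
Qed.

Lemma zero_marginsDZ t E E' :
  zero_margins E -> zero_margins E' -> zero_margins (E + t *: E').
Proof.
move=> [Er Ec] [Er' Ec']; split=> [i|j].
- under eq_bigr => j _ do rewrite !mxE.
  by rewrite big_split -big_distrr /= Er Er' mulr0 addr0.
- under eq_bigr => i _ do rewrite !mxE.
  by rewrite big_split -big_distrr /= Ec Ec' mulr0 addr0.
Qed.

(** Small steps along [E] keep the constraint in two cases: it is slack at [P], or [E] increases
    [kendall] to first order. In both, the thresholds on [t] make the exact quadratic expansion stay
    above [mu]. *)
Lemma kendall_near mu P E :
  mu < kendall P \/ mu <= kendall P /\ 0 < kendall_slope P E ->
  \forall t \near 0^'+, mu <= kendall (P + t *: E).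
Proof.
have kE t : kendall (P + t *: E) =
    kendall P + t * (kendall_slope P E - t * tform E E).
  rewrite kendall_add /kendall_slope; ring.
set g := kendall_slope P E in kE *; set q := tform E E in kE.
case=> [lt_mu|[le_mu g0]].
- have c0 : 0 < `|g| + `|q| + 1 by have := normr_ge0 g; have := normr_ge0 q; lra.
  near=> t; have t0 : 0 < t by near: t; exact: nbhs_right_gt.
  have t1 : t <= 1 by near: t; exact: nbhs_right_le.
  have : t <= (kendall P - mu) / (`|g| + `|q| + 1).
    by near: t; apply: nbhs_right_le; rewrite divr_gt0 // subr_gt0.
  rewrite ler_pdivlMr // kE => tle.
  have : 0 <= t * (g + `|g|).
    by apply: mulr_ge0; [exact: ltW|have := ler_norm (- g); rewrite normrN; lra].
  have : t * (t * q) <= t * `|q|.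
    rewrite ler_wpM2l ?(ltW t0) //; apply: (@le_trans _ _ (t * `|q|)).
      by rewrite ler_wpM2l ?(ltW t0) // ler_norm.
    by rewrite ler_piMl.
  lra.
- have c0 : 0 < `|q| + 1 by have := normr_ge0 q; lra.
  near=> t; have t0 : 0 < t by near: t; exact: nbhs_right_gt.
  have : t <= g / (`|q| + 1).
    by near: t; apply: nbhs_right_le; rewrite divr_gt0.
  rewrite ler_pdivlMr // kE => tle.
  have : t * q <= t * `|q| by rewrite ler_wpM2l ?(ltW t0) // ler_norm.
  move=> tq; apply: (le_trans le_mu); rewrite lerDl mulr_ge0 ?(ltW t0) //.
  lra.
Unshelve. all: by end_near. Qed.

Lemma entry_gt0_near P E : (forall i j, 0 < P i j) ->
  \forall t \near 0^'+, forall i j, 0 < (P + t *: E) i j.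
Proof.
move=> P0; apply: filter_forall => i; apply: filter_forall => j.
have c0 : 0 < 2 * (`|E i j| + 1) by have := normr_ge0 (E i j); lra.
near=> t; have t0 : 0 < t by near: t; exact: nbhs_right_gt.
have : t <= P i j / (2 * (`|E i j| + 1)).
  by near: t; apply: nbhs_right_le; rewrite divr_gt0.
rewrite ler_pdivlMr // !mxE => tle.
have : 0 <= t * (E i j + `|E i j|).
  by apply: mulr_ge0; [exact: ltW|have := ler_norm (- E i j); rewrite normrN; lra].
have := P0 i j; lra.
Unshelve. all: by end_near. Qed.

(** The convexity inequality is taken with the tangent at the moved point and evaluated at [P],
    because [P] itself may still have zero entries. Minimality of [P] then forces the sign. *)
Lemma minimizer_slope_near mu P E : entropy_minimizer mu P -> zero_margins E ->
  (\forall t \near 0^'+, forall i j, 0 < (P + t *: E) i j) ->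
  mu < kendall P \/ mu <= kendall P /\ 0 < kendall_slope P E ->
  \forall t \near 0^'+, 0 <= entropy_slope (P + t *: E) E.
Proof.
move=> [Pcb _ Pmin] E0 Et0 /kendall_near kt.
near=> t; have t0 : 0 < t by near: t; exact: nbhs_right_gt.
have Pt0 : forall i j, 0 < (P + t *: E) i j by near: t.
have Ptk : mu <= kendall (P + t *: E) by near: t.
have Ptcb : checkerboard (P + t *: E).
  by apply: checkerboard_addZ => // i j; exact: ltW.
have [P0 _ _] := Pcb.
have := Ient_tangent _ _ (P + t *: E) P P0 Pt0.
have -> : P - (P + t *: E) = 0 + (- t) *: E.
  by rewrite opprD addrA subrr scaleNr.
have := Pmin _ Ptcb Ptk; rewrite entropy_slopeDZ.
have -> : entropy_slope (P + t *: E) 0 = 0.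
  by rewrite /entropy_slope !big1 // => i _; rewrite big1 // => j _; rewrite [X in _ * X]mxE mulr0.
move=> h1 h2; rewrite -(@pmulr_rge0 _ t) //; lra.
Unshelve. all: by end_near. Qed.

Lemma minimizer_slope_ge0 mu P E : entropy_minimizer mu P -> zero_margins E ->
  (forall i j, 0 < P i j) ->
  mu < kendall P \/ mu <= kendall P /\ 0 < kendall_slope P E ->
  0 <= entropy_slope P E.
Proof.
move=> Pmin E0 P0 dir.
have := minimizer_slope_near _ _ _ Pmin E0 (entry_gt0_near _ _ P0) dir.
apply: cvgr_to_ge.
apply: cvg_at_right_filter; rewrite -[X in entropy_slope X]addr0 -(scale0r E).
apply: cvg_big => [|i _]; first exact: add_continuous.
apply: cvg_big => [|j _]; first exact: add_continuous.
have PtE : (P + t *: E) i j @[t --> (0 : R)] --> (P + 0 *: E) i j.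
  rewrite !mxE; under eq_fun => t do rewrite !mxE.
  by apply: cvgD; [exact: cvg_cst|apply: cvgM; [exact: cvg_id|exact: cvg_cst]].
apply: cvgM; last exact: cvg_cst.
apply: cvgD; last exact: cvg_cst.
apply: (cvg_comp _ _ PtE); apply: continuous_ln.
by rewrite scale0r addr0.
Qed.

(* A vanishing entry would make the entropy slope towards [Q] equal to minus
   infinity; the other entries are controlled by the slope at [Q]. *)
Lemma minimizer_gt0 mu P Q : entropy_minimizer mu P -> checkerboard Q ->
  (forall i j, 0 < Q i j) ->
  mu < kendall P \/ mu <= kendall P /\ 0 < kendall_slope P (Q - P) ->
  forall i j, 0 < P i j.
Proof.
move=> Pmin Qcb Q0 dir i0 j0; have [Pcb _ _] := Pmin.
have [P0 _ _] := Pcb.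
rewrite lt_neqAle P0 andbT; apply/negP => /eqP Pz.
have E0 := zero_margins_sub _ _ _ _ Pcb Qcb.
have Pt0 t i j : 0 < t -> t <= 1 -> 0 < (P + t *: (Q - P)) i j.
  move=> t0 t1; rewrite !mxE.
  have -> : P i j + t * (Q i j - P i j) = (1 - t) * P i j + t * Q i j by ring.
  by rewrite ltr_wpDl ?mulr_gt0 // mulr_ge0 // subr_ge0.
have near0 : \forall t \near (0 : R)^'+, forall i j, 0 < (P + t *: (Q - P)) i j.
  near=> t; have t0 : 0 < t by near: t; exact: nbhs_right_gt.
  have t1 : t <= 1 by near: t; exact: nbhs_right_le.
  by move=> i j; exact: Pt0.
have slope0 := minimizer_slope_near _ _ _ Pmin E0 near0 dir.
(* The bound on [ln t] is chosen to make the slope at this [t] at most -1, against its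
   nonnegativity. *)
have [t [t0 t1 lnt slope_t]] : exists t, [/\ 0 < t, t <= 1,
    ln t <= - (entropy_slope Q (Q - P) + 1) / Q i0 j0 &
    0 <= entropy_slope (P + t *: (Q - P)) (Q - P)].
  near (0 : R)^'+ => t; exists t; split.
  - by near: t; exact: nbhs_right_gt.
  - by near: t; exact: nbhs_right_le.
  - by near: t; have /cvgrNyPle := @lnNy R; apply.
  - by near: t.
suff : entropy_slope (P + t *: (Q - P)) (Q - P) <=
    entropy_slope Q (Q - P) + ln t * Q i0 j0.
  by move: lnt; rewrite ler_pdivlMr //; lra.
(* The moved entry lies between [P i j] and [Q i j], so replacing it by [Q i j] changes the
   logarithm in the direction of the sign of [(Q - P) i j]. *)
have mono i j : (ln ((P + t *: (Q - P)) i j) + 1) * (Q - P) i j <=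
    (ln (Q i j) + 1) * (Q - P) i j.
  have := Pt0 t i j t0 t1; rewrite !mxE => Ptij.
  have [PQ|QP] := leP (P i j) (Q i j).
  - rewrite ler_wpM2r ?subr_ge0 // lerD // ler_ln ?posrE //.
    by have := mulr_ge0 (_ : 0 <= 1 - t) (_ : 0 <= Q i j - P i j); rewrite !subr_ge0; lra.
  - rewrite ler_wnM2r ?subr_le0 ?(ltW QP) // lerD // ler_ln ?posrE //.
    by have := mulr_ge0 (_ : 0 <= 1 - t) (_ : 0 <= P i j - Q i j); rewrite !subr_ge0; lra.
rewrite /entropy_slope (bigD1 i0) //= [X in _ <= X + _](bigD1 i0) //=.
rewrite addrAC lerD //; last first.
  by apply: ler_sum => i _; apply: ler_sum => j _; exact: mono.
rewrite (bigD1 j0) //= [X in _ <= X + _](bigD1 j0) //=.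
rewrite addrAC lerD //; last by apply: ler_sum => j _; exact: mono.
rewrite !mxE -Pz add0r subr0 lnM ?posrE //; lra.
Unshelve. all: by end_near. Qed.

End FirstOrder.

(** * Active constraint and Lagrange multiplier of a minimiser *)

Section KKT.
Variables (R : realType) (n : nat).
Hypothesis n_gt0 : (0 < n)%N.
Implicit Types (P Q E : 'M[R]_n) (i j a b : 'I_n) (mu lam t : R).
Local Notation comonotone := (comonotone R n).
Local Notation independence := (independence R n).

(** The entropy gradient at the independence copula is a constant matrix, hence orthogonal to all
    zero-margin directions. *)
Lemma Ient_independence_le P : checkerboard P -> Ient independence <= Ient P.
Proof.
move=> Pcb; have Icb := checkerboard_independence R n n_gt0.
have [P0 _ _] := Pcb.
have [Er _] := zero_margins_sub _ _ _ _ Icb Pcb.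
have := Ient_tangent _ _ _ _ P0 (independence_gt0 R n).
suff -> : entropy_slope independence (P - independence) = 0 by rewrite addr0.
rewrite /entropy_slope big1 // => i _.
under eq_bigr => j _ do rewrite [independence _ _]mxE.
by rewrite -big_distrr /= Er mulr0.
Qed.

(** If the constraint were slack, the entropy slope towards the independence copula would be
    nonnegative, and Pinsker would give that copula strictly larger [Ient] than [P], although it
    minimises [Ient] over all copulas. *)
Lemma minimizer_kendall_le mu P : 0 <= mu -> entropy_minimizer mu P ->
  kendall P <= mu.
Proof.
move=> mu0 Pmin; have [Pcb _ _] := Pmin; rewrite leNgt; apply/negP => lt_mu.
have Icb := checkerboard_independence R n n_gt0.
have P0 := minimizer_gt0 _ _ _ _ _ Pmin Icb (independence_gt0 R n) (or_introl lt_mu).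
have E0 := zero_margins_sub _ _ _ _ Pcb Icb.
have := minimizer_slope_ge0 _ _ _ _ _ Pmin E0 P0 (or_introl lt_mu).
have := Ient_pinsker _ _ n_gt0 _ _ Pcb Icb P0.
have := Ient_independence_le _ Pcb.
have IP : independence != P.
  apply: contraTneq lt_mu => <-; rewrite kendall_independence // -leNgt.
  exact: mu0.
have := l1norm_gt0 _ _ _ _ IP.
set S := \sum_i \sum_j _ => /(exprn_gt0 2); lra.
Qed.

Lemma kendall_slopeE P E :
  kendall_slope P E = - (tform P E + tform E P).
Proof. by rewrite /kendall_slope sum_Wp; field. Qed.

(** The comonotone copula gives an increasing direction but has zero entries off the diagonal;
    mixing in a little of the independence copula makes it positive. *)
Lemma kendall_increasing_copula P : checkerboard P -> P != comonotone ->
  exists Q, [/\ checkerboard Q, forall i j, 0 < Q i j & 0 < kendall_slope P (Q - P)].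
Proof.
move=> Pcb Pn; set s := kendall_slope P (comonotone - P).
have Ccb := checkerboard_comonotone R n.
have Icb := checkerboard_independence R n n_gt0.
have s0 : 0 < s.
  have := tform_comonotone_add_lt _ _ _ Pcb Pn.
  rewrite /s kendall_slopeE.
  have -> : comonotone - P = comonotone + (- 1) *: P by rewrite scaleN1r.
  rewrite tform_addl tform_addr; lra.
set r := kendall_slope P (independence - comonotone).
have c0 : 0 < 2 * (s + `|r|) by have := normr_ge0 r; lra.
(* With this weight [e * (s + |r|) = s / 2], so the mixing costs less than half of the slope [s]. *)
pose e := s / (2 * (s + `|r|)).
have e0 : 0 < e by rewrite divr_gt0.
have e1 : e < 1 by rewrite ltr_pdivrMr //; have := normr_ge0 r; lra.
pose Q := comonotone + e *: (independence - comonotone).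
have [C0 _ _] := Ccb.
have Q0 i j : 0 < Q i j.
  have -> : Q i j = (1 - e) * comonotone i j + e * independence i j.
    by rewrite /Q !mxE; ring.
  apply: ltr_wpDl; first by apply: mulr_ge0 => //; rewrite subr_ge0 ltW.
  by rewrite mulr_gt0 ?independence_gt0.
exists Q; split=> //.
- apply: checkerboard_addZ => // [|i j]; last exact: ltW.
  exact: zero_margins_sub.
- have -> : Q - P = (comonotone - P) + e *: (independence - comonotone).
    by rewrite /Q addrAC.
  rewrite kendall_slopeDZ -/s -/r.
  have : e * (s + `|r|) = s / 2 by rewrite /e; field; lra.
  have : 0 <= e * (r + `|r|).
    by apply: mulr_ge0; [exact: ltW|have := ler_norm (- r); rewrite normrN; lra].
  have : 0 < e * s by rewrite mulr_gt0.
  lra.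
Qed.

Lemma slope_0 P : entropy_slope P 0 = 0 /\ kendall_slope P 0 = 0.
Proof.
split; first by rewrite /entropy_slope !big1 // => i _; rewrite big1 // => j _; rewrite mxE mulr0.
by rewrite /kendall_slope !big1 ?mulr0 ?oppr0 // => i _; rewrite big1 // => j _; rewrite mxE mul0r.
Qed.

(** The entropy slope is nonnegative wherever the Kendall slope is positive. Perturbing by [E0]
    extends this to the kernel of the Kendall slope, where replacing [E] by its opposite gives zero;
    two linear forms so related are proportional. *)
Lemma minimizer_slope_colinear mu P E0 : entropy_minimizer mu P ->
  (forall i j, 0 < P i j) -> zero_margins E0 -> 0 < kendall_slope P E0 ->
  exists2 c, 0 <= c & forall E, zero_margins E ->
    entropy_slope P E = c * kendall_slope P E.
Proof.
move=> Pmin P0 E0m g0; have [_ Pmu _] := Pmin.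
have ge0 E : zero_margins E -> 0 < kendall_slope P E -> 0 <= entropy_slope P E.
  by move=> Em gE; apply: (minimizer_slope_ge0 _ _ _ _ _ Pmin) => //; right.
have f0 := ge0 _ E0m g0; set f := entropy_slope P in f0 ge0 *.
set g := kendall_slope P in g0 ge0 *.
have kernel_ge0 E : zero_margins E -> g E = 0 -> 0 <= f E.
  move=> Em gE; rewrite leNgt; apply/negP => fE.
  have c0 : 0 < 2 * (f E0 + 1) by lra.
  (* This makes [f (E + e E0) = f E / 2 - e], which is negative; the added 1 keeps the denominator
     positive when [f E0] is 0. *)
  pose e := - f E / (2 * (f E0 + 1)).
  have e0 : 0 < e by rewrite divr_gt0 // oppr_gt0.
  have := ge0 _ (zero_marginsDZ _ _ e _ _ Em E0m).
  rewrite /f /g entropy_slopeDZ kendall_slopeDZ -/f -/g gE add0r mulr_gt0 //.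
  move=> /(_ isT).
  have : e * (f E0 + 1) = - f E / 2 by rewrite /e; field; lra.
  lra.
have kernel E : zero_margins E -> g E = 0 -> f E = 0.
  move=> Em gE; apply/eqP; rewrite eq_le kernel_ge0 // andbT.
  have [f00 g00] := slope_0 P.
  have z0 : zero_margins (0 : 'M[R]_n).
    by split=> ?; rewrite big1 // => ? _; rewrite mxE.
  have := kernel_ge0 _ (zero_marginsDZ _ _ (- 1) _ _ z0 Em).
  rewrite /f /g entropy_slopeDZ kendall_slopeDZ f00 g00 -/f -/g gE.
  by rewrite mulr0 addr0 => /(_ erefl); lra.
exists (f E0 / g E0); first by rewrite divr_ge0 // ltW.
move=> E Em; have gn : g E0 != 0 by rewrite gt_eqF.
have := kernel _ (zero_marginsDZ _ _ (- (g E / g E0)) _ _ Em E0m).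
rewrite /f /g entropy_slopeDZ kendall_slopeDZ -/f -/g mulNr divfK // subrr.
move=> /(_ erefl) /eqP; rewrite mulNr subr_eq0 => /eqP ->.
by field.
Qed.

Lemma sum_delta_mx (F : 'I_n -> 'I_n -> R) i j :
  \sum_a \sum_b F a b * (delta_mx i j : 'M[R]_n) a b = F i j.
Proof.
rewrite (bigD1 i) //= (bigD1 j) //= mxE !eqxx mulr1.
rewrite big1 => [|b bj]; last by rewrite mxE (negPf bj) andbF mulr0.
rewrite big1 ?addr0 // => a ai; rewrite big1 // => b _.
by rewrite mxE (negPf ai) mulr0.
Qed.

(** Testing against the rectangle swap with corners [(i, j)] and [(o, o)] gives
    [F i j = F i o + F o j - F o o]. *)
Lemma swap_orthogonal_separable (F : 'I_n -> 'I_n -> R) :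
  (forall E, zero_margins E -> \sum_i \sum_j F i j * E i j = 0) ->
  exists alpha beta : 'I_n -> R, forall i j, F i j - alpha j - beta i = 0.
Proof.
move=> F0; pose o := Ordinal n_gt0.
exists (fun j => F o j - F o o), (fun i => F i o) => i j.
pose E : 'M[R]_n := delta_mx i j - delta_mx i o - delta_mx o j + delta_mx o o.
have sum_row (a b c : 'I_n) : \sum_d (delta_mx a b : 'M[R]_n) c d = (c == a)%:R.
  rewrite (bigD1 b) //= big1 => [|d db]; first by rewrite mxE eqxx andbT addr0.
  by rewrite mxE (negPf db) andbF.
have sum_col (a b d : 'I_n) : \sum_c (delta_mx a b : 'M[R]_n) c d = (d == b)%:R.
  rewrite (bigD1 a) //= big1 => [|c ca]; first by rewrite mxE eqxx addr0.
  by rewrite mxE (negPf ca).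
have Em : zero_margins E.
  split=> [a|b].
  - transitivity (\sum_d ((delta_mx i j : 'M[R]_n) a d - (delta_mx i o : 'M[R]_n) a d
      - (delta_mx o j : 'M[R]_n) a d + (delta_mx o o : 'M[R]_n) a d)).
      by apply: eq_bigr => d _; rewrite !mxE.
    by rewrite big_split !sumrB !sum_row /=; ring.
  - transitivity (\sum_c ((delta_mx i j : 'M[R]_n) c b - (delta_mx i o : 'M[R]_n) c b
      - (delta_mx o j : 'M[R]_n) c b + (delta_mx o o : 'M[R]_n) c b)).
      by apply: eq_bigr => c _; rewrite !mxE.
    by rewrite big_split !sumrB !sum_col /=; ring.
rewrite -(F0 _ Em).
transitivity (\sum_a \sum_b F a b * (delta_mx i j : 'M[R]_n) a b
  - \sum_a \sum_b F a b * (delta_mx i o : 'M[R]_n) a b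
  - \sum_a \sum_b F a b * (delta_mx o j : 'M[R]_n) a b
  + \sum_a \sum_b F a b * (delta_mx o o : 'M[R]_n) a b).
  by rewrite !sum_delta_mx; ring.
rewrite -!sumrB -big_split; apply: eq_bigr => a _.
rewrite -!sumrB -big_split; apply: eq_bigr => b _ /=; rewrite !mxE; ring.
Qed.

Lemma minimizer_kkt mu P : 0 <= mu < 1 - n%:R^-1 -> entropy_minimizer mu P ->
  [/\ forall i j, 0 < P i j, kendall P = mu &
    exists lam (alpha beta : 'I_n -> R), 0 <= lam /\
      forall i j, ln (P i j) + 1 + lam * Wp P i j - alpha j - beta i = 0].
Proof.
move=> /andP[mu0 mu1] Pmin; have [Pcb Pmu _] := Pmin.
have Pk : kendall P = mu.
  by apply/eqP; rewrite eq_le Pmu andbT; exact: minimizer_kendall_le.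
have Pn : P != comonotone.
  by apply: contraTneq mu1 => PC; rewrite -Pk PC kendall_comonotone // ltxx.
have [Q [Qcb Q0 slopeQ]] := kendall_increasing_copula _ Pcb Pn.
have P0 : forall i j, 0 < P i j.
  by apply: (minimizer_gt0 _ _ _ _ _ Pmin Qcb Q0); right.
split=> //.
have [c c0 fg] := minimizer_slope_colinear _ _ _ Pmin P0
  (zero_margins_sub _ _ _ _ Pcb Qcb) slopeQ.
(* The multiplier is [2 * c], as [kendall_slope] is -2 times the pairing with [Wp]. *)
have [E Em|alpha [beta kkt]] :=
  swap_orthogonal_separable (fun i j => ln (P i j) + 1 + 2 * c * Wp P i j).
  have := fg _ Em; rewrite /entropy_slope /kendall_slope => fgE.
  transitivity (\sum_i \sum_j (ln (P i j) + 1) * E i j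
     + 2 * c * \sum_i \sum_j E i j * Wp P i j); last by rewrite fgE; ring.
  rewrite big_distrr -big_split; apply: eq_bigr => i _.
  rewrite big_distrr -big_split; apply: eq_bigr => j _ /=; ring.
by exists (2 * c), alpha, beta; split=> //; rewrite mulr_ge0.
Qed.

End KKT.

Theorem theorem4 (R : realType) (n : nat) (mu : R) :
  (2 <= n)%N ->
  0 <= mu <= 1 - (n%:R)^-1 ->
  (forall lam : R, lagrange_multiplier n mu lam -> lam < 2) ->
  exists! P : 'M[R]_n, optimal mu P.
Proof.
move=> /ltnW n_gt0 /andP[mu0]; rewrite le_eqVlt => /predU1P[-> _|mu1 lam_lt2].
(* At the maximal value the feasible set is a single point, and no multiplier is involved. *)
- have Ccb := checkerboard_comonotone R n.
  have only (Q : 'M[R]_n) : feasible (1 - n%:R^-1) Q -> Q = comonotone R n.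
    case=> Qcb Qk; apply: contra_eq Qk => Qn.
    by rewrite lt_eqF // kendall_lt.
  exists (comonotone R n); split=> [|Q [/only ->] //].
  split=> [|Q /only -> //]; split=> //; exact: kendall_comonotone.
- have [P Pmin] := entropy_minimizer_exists R n mu n_gt0 (ltW mu1).
  have mu01 : 0 <= mu < 1 - n%:R^-1 by rewrite mu0.
  have [P0 Pk [lam [alpha [beta [lam0 kkt]]]]] := minimizer_kkt R n n_gt0 mu P mu01 Pmin.
  have [Pcb _ PI] := Pmin.
  have lam2 : lam < 2 by apply: lam_lt2; exists P; split=> //; exists alpha, beta.
  exists P; split=> [|Q [[Qcb Qk] QI]].
    (* The minimiser over the larger set satisfies the constraint with equality, hence is optimal
       for the original problem. *)
    by split=> // Q [Qcb Qk]; apply: PI => //; rewrite Qk.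
  apply/eqP; rewrite eq_sym; apply: contraT => QP.
  have PQ : kendall P = kendall Q by rewrite Pk Qk.
  have lam02 : 0 <= lam < 2 by rewrite lam0.
  have := kkt_lt R n n_gt0 P Q lam alpha beta Pcb Qcb P0 PQ lam02 kkt QP.
  by rewrite ltNge QI.
Qed.
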